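(* Let $X$ be a nonempty Borel space, $Q$ a stochastic kernel on $X$, and $\Phi,\Psi\subset X$ Borel measurable sets. Define the random times $$\tau:=\inf\{t\in\mathbb N_0: X_t\in\Psi\},\qquad \tau':=\inf\{t\in\mathbb N_0: X_t\in X\setminus(\Phi\cup\Psi)\}.$$ Assume that $\tau\wedge\tau'<\infty$ almost surely (i.e. $\mathbb P_x(\tau\wedge\tau'<\infty)=1$ for every $x\in X$). Then for every $u\in\mathcal M_b^{01}(\Phi,\Psi)$: (i) $u\le V$ whenever $u$ satisfies the functional inequality $u\le L[u]$; (ii) $u\ge V$ whenever $u$ satisfies $u\ge L[u]$; where all inequalities are interpreted pointwise on $X$. In particular, $V$ is the unique solution of the equation $u=L[u]$ in the set $\mathcal M_b^{01}(\Phi,\Psi)$.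
   Context: A Borel space is a Borel subset $X$ of a Polish space, with Borel $\sigma$-algebra $\mathfrak B(X)$; ''measurable'' means Borel measurable. A stochastic kernel on $X$ is a map $Q:X\times\mathfrak B(X)\to[0,1]$ such that $Q(x,\cdot)$ is a probability measure for each $x\in X$ and $Q(\cdot,B)$ is measurable for each $B\in\mathfrak B(X)$. Let $\Omega:=\prod_{i=0}^\infty X$ with the product $\sigma$-algebra and coordinate process $X_t(\omega)=\omega(t)$, $t\in\mathbb N_0=\{0,1,2,\dots\}$. For $x\in X$, $\mathbb P_x$ is the unique probability measure on $\Omega$ with $\mathbb P_x(X_0\in B)=\delta_x(B)$ and $\mathbb P_x(X_{t+1}\in B\mid X_0,\dots,X_t)=Q(X_t,B)$ for all $B\in\mathfrak B(X)$, $t\in\mathbb N_0$. Convention: $\inf\varnothing=\infty$, and $a\wedge b=\min\{a,b\}$. $\mathcal M_b(X)$ is the set of bounded measurable functions $X\to\mathbb R$, and $L:\mathcal M_b(X)\to\mathcal M_b(X)$ is defined by $$L[W](x):=\mathbf 1_\Psi(x)+\mathbf 1_{\Phi\setminus\Psi}(x)\int_X Q(x,\mathrm d\xi)\,W(\xi).$$ $\mathcal M_b^{01}(\Phi,\Psi)\subset\mathcal M_b(X)$ is the set of $W\in\mathcal M_b(X)$ such that $0\le W(x)\le1$ for all $x\in X$, $W(x)=1$ for all $x\in\Psi$, and $W(x)=0$ for all $x\in X\setminus(\Phi\cup\Psi)$. Define $V_0:=\mathbf 1_\Psi$, $V_{k+1}:=L[V_k]$ for $k\ge0$, and $V(x):=\lim_{k\to+\infty}V_k(x)$;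 the limit exists because, for every $x$, $(V_k(x))_k$ is nondecreasing and bounded by $1$. Equivalently, $V(x)$ is the $\mathbb P_x$-probability that there is $i\in\mathbb N_0$ with $X_i\in\Psi$ and $X_j\in\Phi$ for all $j<i$. *)

(* Defs.v *)
From HB Require Import structures.
From mathcomp Require Import all_boot all_order all_algebra.
From mathcomp Require Import all_classical all_reals all_analysis.
From mathcomp Require Import measurable_realfun.

Set Implicit Arguments.
Unset Strict Implicit.
Unset Printing Implicit Defensive.

Import Order.TTheory GRing.Theory Num.Theory.
Import numFieldNormedType.Exports.

Local Open Scope classical_set_scope.
Local Open Scope ring_scope.

Section polish.
Variables (R : realType) (S : topologicalType).

(* [dist] is a complete metric inducing the given topology of [S];
   nonnegativity follows from the three metric axioms. *)
Definition complete_metric (dist : S -> S -> R) : Prop :=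
  [/\ forall x y, dist x y = 0 <-> x = y,
      forall x y, dist x y = dist y x,
      forall x y z, dist x z <= dist x y + dist y z,
      forall U : set S, open U <->
        (forall x, U x ->
           exists2 e : R, 0 < e & [set y | dist x y < e] `<=` U) &
      forall s : nat -> S,
        (forall e : R, 0 < e -> exists N : nat, forall m n,
           (N <= m)%N -> (N <= n)%N -> dist (s m) (s n) < e) ->
        exists l : S, s @ \oo --> l].

Definition polish : Prop :=
  (exists2 D : set S, countable D & dense D) /\
  (exists dist : S -> S -> R, complete_metric dist).

End polish.

Definition borel_set (S : topologicalType) (A : set S) : Prop :=
  <<s [set U : set S | open U] >> A.

(* A measurable type must be pointed, so the subtype of the points of [A] is
   tagged with a proof that [A] is nonempty. *)
Definition nonempty_subtype (S : topologicalType) (A : set S)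
  (A0 : A !=set0) : Type := set_type A.

HB.instance Definition _ (S : topologicalType) (A : set S) (A0 : A !=set0) :=
  Choice.on (nonempty_subtype A0).

HB.instance Definition _ (S : topologicalType) (A : set S) (A0 : A !=set0) :=
  isPointed.Build (nonempty_subtype A0)
    (exist _ (sval (cid A0)) (mem_set (svalP (cid A0))) : set_type A).

(* [A] with the Borel sigma-algebra of its subspace topology. *)
Definition borel_space (S : topologicalType) (A : set S) (A0 : A !=set0) :=
  @g_sigma_algebraType (nonempty_subtype A0) [set U : set (set_type A) | open U].

Section trajectories.
Variables (d : measure_display) (X : measurableType d).

(* The countable power of [X] with the product sigma-algebra. *)
Definition trajectory := g_sigma_algebraType
  (\bigcup_t preimage_set_system setT (fun w : nat -> X => w t) measurable).

Definition coordinate (t : nat) (w : trajectory) : X := w t.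

(* The sigma-algebra generated by the coordinates 0, ..., t. *)
Definition past (t : nat) : set (set trajectory) :=
  <<s \bigcup_(i in [set i | (i <= t)%N])
        preimage_set_system setT (coordinate i) measurable >>.

End trajectories.

(* [f] is a version of the conditional probability P(E | G). *)
Definition is_cond_prob (d : measure_display) (T : measurableType d)
    (R : realType) (P : probability T R) (G : set (set T)) (E : set T)
    (f : T -> \bar R) : Prop :=
  [/\ forall B : set (\bar R), measurable B -> G (f @^-1` B),
      P.-integrable setT f &
      forall A, G A -> (\int[P]_(w in A) f w = P (A `&` E))%E].

Section markov.
Variables (R : realType) (d : measure_display) (X : measurableType d).
Variable Q : R.-pker X ~> X.

Definition markov_law (x : X) (P : probability (trajectory X) R) : Prop :=
  (forall B : set X, measurable B ->
     P (coordinate 0 @^-1` B) = dirac x B) /\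
  (forall (t : nat) (B : set X), measurable B ->
     is_cond_prob P (past t) (coordinate t.+1 @^-1` B) (fun w => Q (coordinate t w) B)).

Variables Phi Psi : set X.

(* The infimum in the extended reals, so that it is +oo on the empty set. *)
Definition hitting_time (A : set X) (w : trajectory X) : \bar R :=
  ereal_inf [set t%:R%:E | t in [set t : nat | A (coordinate t w)]].

Definition bounded_measurable (W : X -> R) : Prop :=
  measurable_fun setT W /\ exists M : R, forall x, `|W x| <= M.

(* Meaningful on bounded measurable functions, which it preserves. *)
Definition L (W : X -> R) : X -> R := fun x =>
  \1_Psi x + \1_(Phi `\` Psi) x * (\int[Q x]_xi W xi)%R.

Definition bounded_measurable01 (W : X -> R) : Prop :=
  [/\ bounded_measurable W,
      forall x, 0 <= W x <= 1,
      forall x, Psi x -> W x = 1 &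
      forall x, (~` (Phi `|` Psi)) x -> W x = 0].

Definition Viter (k : nat) : X -> R := iter k L (\1_Psi : X -> R).

Definition V (x : X) : R := limn (fun k => Viter k x).

End markov.

(* Main.v *)
Require Import Defs.
From mathcomp Require Import all_boot all_order all_algebra.
From mathcomp Require Import all_classical all_reals all_analysis.
From mathcomp Require Import measurable_realfun.

Set Implicit Arguments.
Unset Strict Implicit.
Unset Printing Implicit Defensive.

Import Order.TTheory GRing.Theory Num.Theory.
Import numFieldNormedType.Exports.

Local Open Scope classical_set_scope.
Local Open Scope ring_scope.

(** Iterating a subsolution [u <= L u] gives [u <= V_k + s_k], where [s_k x] is
    the probability that the chain started at [x] stays in [Phi `\` Psi] up to
    time [k]; the exit hypothesis says exactly that [s_k] tends to [0].  A
    supersolution dominates every [V_k] by monotonicity of [L].  For the fixed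
    point, [V <= L V] is immediate, hence [L V] is a subsolution by monotonicity
    and the first part gives [L V <= V]. *)

(** * Integration against a disintegrated measure *)

Section disintegration.
Context d d' (T : measurableType d) (X : measurableType d') (R : realType).
Variables (mu : {measure set T -> \bar R}) (k : T -> {measure set X -> \bar R}).
Hypothesis mk : forall B, measurable B -> measurable_fun setT (k ^~ B).
Variables (Y : T -> X) (A : set T).
Hypotheses (mY : measurable_fun setT Y) (mA : measurable A).
Hypothesis disint : forall B, measurable B ->
  (\int[mu]_(w in A) k w B = mu (A `&` Y @^-1` B))%E.
Local Open Scope ereal_scope.
Import HBNNSimple.

Lemma nnsfun_disintegration (h : {nnsfun X >-> R}) :
  \int[mu]_(w in A) (h (Y w))%:E = \int[mu]_(w in A) \int[k w]_z (h z)%:E.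
Proof.
have mh r : measurable (h @^-1` [set r]) by exact: measurable_sfunP.
have mhY r : measurable (Y @^-1` (h @^-1` [set r])).
  by rewrite -[X in measurable X]setTI; exact: mY.
under [RHS]eq_integral do rewrite integralT_nnsfun sintegralE.
rewrite ge0_integral_fsum//; last 2 first.
- by move=> r; apply: measurable_funeM; exact: measurable_funS (mk _).
- by move=> r w _; exact: nnsfun_mulemu_ge0.
under [LHS]eq_integral do rewrite fimfunE -fsumEFin//.
rewrite ge0_integral_fsum//; last 2 first.
- move=> r; apply/measurable_EFinP/measurable_funM => //.
  exact: measurable_indic (mhY r).
- by move=> r w _; rewrite EFinM nnfun_muleindic_ge0.
apply: eq_fsbigr => r; rewrite inE => -[z _ hz].
(* The sum ranges only over values taken by [h], which makes [r] nonnegative and lets it leave the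
   integrals. *)
have r0 : (0 <= r)%R by rewrite -hz.
rewrite ge0_integralZl//; last exact: measurable_funS (mk _).
under eq_integral do rewrite EFinM.
rewrite ge0_integralZl//; last first.
  by apply/measurable_EFinP; exact: measurable_indic (mhY r).
by rewrite disint// (integral_indic _ mA (mhY r)) setIC.
Qed.

(** The Markov property is stated for events only; this carries it over to functions. Simple
    functions increase to [f], and monotone convergence is applied once on the left and twice on the
    right, under [mu] and inside each [k w]. *)
Lemma ge0_disintegration (f : X -> \bar R) : (forall z, 0 <= f z) ->
  measurable_fun setT f ->
  \int[mu]_(w in A) f (Y w) = \int[mu]_(w in A) \int[k w]_z f z.
Proof.
move=> f0 mf; pose h := nnsfun_approx measurableT mf.
have h_cvg z : (h n z)%:E @[n --> \oo] --> f z by exact: cvg_nnsfun_approx.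
have h_nd z : {homo (fun n => (h n z)%:E) : m n / (m <= n)%N >-> m <= n}.
  by move=> m n mn; rewrite lee_fin; exact/lefP/nd_nnsfun_approx.
transitivity (limn (fun n => \int[mu]_(w in A) (h n (Y w))%:E)).
  rewrite -monotone_convergence//.
  - by apply: eq_integral => w _; apply/esym/cvg_lim => //; exact: h_cvg.
  - move=> n; apply/measurable_EFinP.
    by apply: measurable_funTS; exact: measurableT_comp.
  - by move=> n w _; rewrite lee_fin.
transitivity (limn (fun n => \int[mu]_(w in A) \int[k w]_z (h n z)%:E)).
  by congr (limn _); apply/funext => n; exact: nnsfun_disintegration.
rewrite -monotone_convergence//; first last.
- move=> w _ m n mn; apply: ge0_le_integral => //.
  + by move=> z _; rewrite lee_fin.
  + exact/measurable_EFinP.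
  + exact/measurable_EFinP.
  + by move=> z _; exact: h_nd.
- by move=> n w _; apply: integral_ge0 => z _; rewrite lee_fin.
- move=> n; apply: measurable_funTS.
  apply: measurable_fun_integral_kernel => //.
  + by move=> z; rewrite lee_fin.
  + exact/measurable_EFinP.
apply: eq_integral => w _; rewrite -monotone_convergence//.
- by apply: eq_integral => z _; apply/cvg_lim => //; exact: h_cvg.
- by move=> n; exact/measurable_EFinP.
- by move=> n z _; rewrite lee_fin.
Qed.

End disintegration.

(** * Functions with values in the unit interval and their kernel integrals *)

Section unit_functions.
Context d (X : measurableType d) (R : realType).

(** Free of the boundary conditions on [Phi] and [Psi], so that it covers the value iterates, the
    survival functions and their kernel integrals alike. *)
Definition measurable01 (f : X -> R) :=
  measurable_fun setT f /\ forall x, 0 <= f x <= 1.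

Lemma indic_measurable01 (B : set X) : measurable B ->
  measurable01 (\1_B : X -> R).
Proof.
move=> mB; split => [|x]; first exact: measurable_indic.
by rewrite indicE; case: (_ \in _); rewrite lexx ler01.
Qed.

Variable Q : R.-pker X ~> X.

Lemma measurable01_integrable (f : X -> R) x : measurable01 f ->
  (Q x).-integrable setT (EFin \o f).
Proof.
move=> [mf f01]; apply: measurable_bounded_integrable => //.
  by rewrite prob_kernel ltry.
exists 1; split => // M M1 y _ /=; have /andP[f0 f1] := f01 y.
by rewrite ger0_norm// (le_trans f1)// ltW.
Qed.

Lemma EFin_kernel_integral (f : X -> R) x : measurable01 f ->
  (\int[Q x]_y f y)%R%:E = (\int[Q x]_y (f y)%:E)%E.
Proof.
by move=> f01; rewrite /Rintegral fineK// integrable_fin_num//;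
  exact: measurable01_integrable.
Qed.

Lemma kernel_integral_measurable01 (f : X -> R) : measurable01 f ->
  measurable01 (fun x => \int[Q x]_y f y).
Proof.
move=> f01; have [mf ge0] := f01; split => [|x].
  apply/measurable_EFinP => /=.
  under [X in measurable_fun _ X]eq_fun do rewrite /= EFin_kernel_integral//.
  apply: measurable_fun_integral_kernel => [U mU|z|].
  - exact: measurable_kernel.
  - by rewrite lee_fin; case/andP: (ge0 z).
  - exact/measurable_EFinP.
apply/andP; split.
  by apply: Rintegral_ge0 => y _; case/andP: (ge0 y).
rewrite -lee_fin EFin_kernel_integral//.
apply: (@le_trans _ _ (\int[Q x]_y (cst 1 y))%E).
  apply: ge0_le_integral => //.
  - by move=> y _; rewrite lee_fin; case/andP: (ge0 y).
  - exact/measurable_EFinP.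
  - by move=> y _; rewrite lee_fin; case/andP: (ge0 y).
by rewrite integral_cst// prob_kernel mule1.
Qed.

Lemma le_kernel_integral (f g : X -> R) x :
  measurable01 f -> measurable01 g -> (forall y, f y <= g y) ->
  \int[Q x]_y f y <= \int[Q x]_y g y.
Proof.
by move=> f01 g01 fg; apply: le_Rintegral => //; exact: measurable01_integrable.
Qed.

(** * The operator [L], its iterates and their limit *)

Section operator.
Variables Phi Psi : set X.
Hypotheses (mPhi : measurable Phi) (mPsi : measurable Psi).
Let G := Phi `\` Psi.
Let mG : measurable G. Proof. exact: measurableD. Qed.

Lemma bounded_measurable01P (u : X -> R) :
  bounded_measurable01 Phi Psi u <->
  [/\ measurable01 u, forall x, Psi x -> u x = 1 &
      forall x, (~` (Phi `|` Psi)) x -> u x = 0].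
Proof.
split => [[[mu _] u01 u1 u0]//|[[mu u01] u1 u0]]; split => //; split => //.
by exists 1 => x; have /andP[? ?] := u01 x; rewrite ger0_norm.
Qed.

Lemma L_on_Psi (W : X -> R) x : Psi x -> L Q Phi Psi W x = 1.
Proof.
by move=> Psix; rewrite /L !indicE mem_set// memNset ?mul0r ?addr0// => -[].
Qed.

Lemma L_on_diff (W : X -> R) x : G x -> L Q Phi Psi W x = \int[Q x]_y W y.
Proof.
by move=> Gx; rewrite /L !indicE (mem_set Gx) memNset ?mul1r ?add0r//; case: Gx.
Qed.

Lemma L_off_union (W : X -> R) x : (~` (Phi `|` Psi)) x -> L Q Phi Psi W x = 0.
Proof.
move=> nx; rewrite /L !indicE !memNset ?mul0r ?addr0//.
- by move=> [Px _]; apply: nx; left.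
- by move=> Px; apply: nx; right.
Qed.

Lemma L_bounded_measurable01 (W : X -> R) : measurable01 W ->
  bounded_measurable01 Phi Psi (L Q Phi Psi W).
Proof.
move=> W01; have [mW IW01] := kernel_integral_measurable01 W01.
apply/bounded_measurable01P; split; [split| |].
- apply: measurable_funD; first exact: measurable_indic.
  by apply: measurable_funM => //; exact: measurable_indic.
- move=> x; have [Psix|nPsix] := pselect (Psi x).
    by rewrite L_on_Psi// ler01 lexx.
  have [Phix|nPhix] := pselect (Phi x); first by rewrite L_on_diff.
  by rewrite L_off_union ?lexx ?ler01// => -[].
- exact: L_on_Psi.
- exact: L_off_union.
Qed.

Lemma L_measurable01 (W : X -> R) : measurable01 W ->
  measurable01 (L Q Phi Psi W).
Proof. by move=> /L_bounded_measurable01/bounded_measurable01P[]. Qed.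

Lemma le_L (W W' : X -> R) : measurable01 W -> measurable01 W' ->
  (forall x, W x <= W' x) -> forall x, L Q Phi Psi W x <= L Q Phi Psi W' x.
Proof.
move=> W01 W'01 WW' x.
by rewrite lerD2l ler_wpM2l//; exact: le_kernel_integral.
Qed.

Lemma Viter_measurable01 n : measurable01 (Viter Q Phi Psi n).
Proof.
elim: n => [|n IHn]; first exact: indic_measurable01.
exact: L_measurable01.
Qed.

Lemma Viter_nondecreasing x :
  nondecreasing_seq (fun n => Viter Q Phi Psi n x).
Proof.
apply/nondecreasing_seqP => n; elim: n x => [|n IHn] x; last first.
  by apply: le_L IHn x; exact: Viter_measurable01.
(* Base case: the first iterate is the indicator of [Psi] plus a nonnegative term. *)
rewrite /Viter/= lerDl mulr_ge0//.
by apply: Rintegral_ge0 => y _.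
Qed.

Lemma is_cvg_Viter x : cvgn (fun n => Viter Q Phi Psi n x).
Proof.
apply: nondecreasing_is_cvgn; first exact: Viter_nondecreasing.
by exists 1 => _ [n _ <-]; case/andP: ((Viter_measurable01 n).2 x).
Qed.

Lemma Viter_le_V n x : Viter Q Phi Psi n x <= V Q Phi Psi x.
Proof.
by apply: nondecreasing_cvgn_le; [exact: Viter_nondecreasing|exact: is_cvg_Viter].
Qed.

Lemma V_le_ub (M : R) x :
  (forall n, Viter Q Phi Psi n x <= M) -> V Q Phi Psi x <= M.
Proof.
move=> VM; apply: limr_le; first exact: is_cvg_Viter.
by near=> n; exact: VM.
Unshelve. all: by end_near. Qed.

Lemma V_measurable01 : measurable01 (V Q Phi Psi).
Proof.
split => [|x].
  apply: (measurable_fun_cvg (h := Viter Q Phi Psi)) => [n|x _].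
    exact: (Viter_measurable01 n).1.
  exact: is_cvg_Viter.
apply/andP; split.
  apply: le_trans (Viter_le_V 0 x).
  by case/andP: ((Viter_measurable01 0).2 x).
by apply: V_le_ub => n; case/andP: ((Viter_measurable01 n).2 x).
Qed.

Lemma V_bounded_measurable01 : bounded_measurable01 Phi Psi (V Q Phi Psi).
Proof.
apply/bounded_measurable01P; split=> [|x Psix|x nx]; first exact: V_measurable01.
- apply/eqP; rewrite eq_le; case/andP: (V_measurable01.2 x) => _ -> /=.
  by apply: le_trans (Viter_le_V 0 x); rewrite /Viter/= indicE mem_set.
- apply/eqP; rewrite eq_le; case/andP: (V_measurable01.2 x) => -> _.
  (* Every later iterate is a value of [L], hence zero here; the initial one is an indicator and is
     treated apart. *)
  rewrite andbT; apply: V_le_ub => -[|n]; last by rewrite /Viter iterS L_off_union.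
  by rewrite /Viter/= indicE memNset// => Px; apply: nx; right.
Qed.

(** Monotonicity of [L] gives [V_n <= V_(n+1) = L V_n <= L V]; then take the supremum over [n]. *)
Lemma V_le_LV x : V Q Phi Psi x <= L Q Phi Psi (V Q Phi Psi) x.
Proof.
apply: V_le_ub => n; apply: le_trans (Viter_nondecreasing x (leqnSn n)) _.
apply: le_L => //; first exact: Viter_measurable01.
- exact: V_measurable01.
- exact: Viter_le_V.
Qed.

Lemma V_le_supersolution (u : X -> R) : bounded_measurable01 Phi Psi u ->
  (forall x, L Q Phi Psi u x <= u x) -> forall x, V Q Phi Psi x <= u x.
Proof.
move=> /bounded_measurable01P[u01 u1 u0] Lu x; apply: V_le_ub => n.
elim: n x => [|n IHn] x.
  rewrite /Viter/= indicE; have [/set_mem/u1 ->//|_] := boolP (x \in Psi).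
  by case/andP: (u01.2 x).
apply: le_trans (Lu x); apply: le_L => //; exact: Viter_measurable01.
Qed.

End operator.

(** * Survival probabilities *)

Section survival.
Variable G : set X.
Hypothesis mG : measurable G.

(* With no target, [L] keeps only the sub-Markov part of [Q] on [G], so this is
   the probability that the chain started at [x] stays in [G] up to time [n]. *)
Definition survival n : X -> R := iter n (L Q G set0) \1_G.

Lemma survival_measurable01 n : measurable01 (survival n).
Proof.
elim: n => [|n IHn]; first exact: indic_measurable01.
exact: L_measurable01.
Qed.

Lemma survivalS n x : G x -> survival n.+1 x = \int[Q x]_y survival n y.
Proof. by move=> Gx; rewrite /survival iterS L_on_diff// setD0. Qed.

Lemma survival_out n x : ~ G x -> survival n x = 0.
Proof.
case: n => [|n] nGx; first by rewrite /survival/= indicE memNset.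
by rewrite /survival iterS L_off_union// setU0.
Qed.

End survival.

(** Off [Phi]\[Psi] the boundary values of [u] already settle the bound. On it, [L] is integration
    against [Q x], which is additive, so the bound for [n] integrates to the one for [n.+1]. *)
Lemma subsolution_le_Viter (Phi Psi : set X) (u : X -> R) :
  measurable Phi -> measurable Psi -> bounded_measurable01 Phi Psi u ->
  (forall x, u x <= L Q Phi Psi u x) ->
  forall n x, u x <= Viter Q Phi Psi n x + survival (Phi `\` Psi) n x.
Proof.
move=> mPhi mPsi /bounded_measurable01P[u01 u1 u0] uL.
have mG : measurable (Phi `\` Psi) by exact: measurableD.
elim=> [|n IHn] x.
  have [Psix|nPsix] := pselect (Psi x).
    rewrite u1// /Viter/= indicE mem_set// lerDl.
    by case/andP: ((survival_measurable01 mG 0).2 x).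
  have [Phix|nPhix] := pselect (Phi x); last first.
    rewrite u0; last by case.
    by rewrite addr_ge0.
  rewrite /Viter /survival/= !indicE memNset// mem_set// add0r.
  by case/andP: (u01.2 x).
have [Gx|nGx] := pselect ((Phi `\` Psi) x); last first.
  rewrite (survival_out _ nGx) addr0.
  have [Psix|nPsix] := pselect (Psi x).
    by rewrite u1// /Viter iterS L_on_Psi.
  rewrite u0; last by move=> [Phix|//]; exact: nGx.
  by case/andP: ((Viter_measurable01 mPhi mPsi n.+1).2 x).
rewrite survivalS// /Viter iterS L_on_diff// (le_trans (uL x))// L_on_diff//.
have V01 := Viter_measurable01 mPhi mPsi n.
have s01 := survival_measurable01 mG n.
rewrite -RintegralD//; [|exact: measurable01_integrable..].
apply: le_Rintegral => //; first exact: measurable01_integrable.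
(* The sum is not known here to be at most one, so its integrability comes from that of the two
   summands. *)
have := integrableD measurableT (measurable01_integrable x V01)
  (measurable01_integrable x s01).
by [].
Qed.

End unit_functions.

(** * Survival as the probability of a trajectory event *)

Section trajectories.
Context d (X : measurableType d) (R : realType).

Lemma measurable_coordinate t : measurable_fun setT (@coordinate d X t).
Proof.
by move=> _ B mB; apply: sub_sigma_algebra; exists t => //; exists B.
Qed.

Definition stay (G : set X) (t : nat) : set (trajectory X) :=
  \bigcap_(i in [set i | (i <= t)%N]) (coordinate i @^-1` G).

Lemma stayS (G : set X) t : stay G t.+1 = stay G t `&` coordinate t.+1 @^-1` G.
Proof.
apply/seteqP; split=> w.
  move=> sw; split=> [i /= it|]; last exact: sw (leqnn _).
  by apply: sw; exact: leqW.
by move=> [sw Gw] i /=; rewrite leq_eqVlt => /predU1P[->//|]; exact: sw.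
Qed.

(** Conditional probabilities may be integrated only over events of the past; this admits [stay G t]
    as such an event. *)
Lemma past_stay (G : set X) t : measurable G -> past t (stay G t).
Proof.
move=> mG.
pose F := \bigcup_(i in [set i | (i <= t)%N])
  preimage_set_system setT (@coordinate d X i) measurable.
apply: (@bigcap_measurable _ (g_sigma_algebraType F)); first by exists 0%N.
move=> i it; apply: sub_sigma_algebra; exists i => //; exists G => //.
by rewrite setTI.
Qed.

Lemma measurable_stay (G : set X) t : measurable G -> measurable (stay G t).
Proof.
move=> mG; apply: bigcap_measurable => [|i _]; first by exists 0%N.
by rewrite -[X in measurable X]setTI; exact: measurable_coordinate.
Qed.

Variables (Q : R.-pker X ~> X) (x : X) (P : probability (trajectory X) R).
Hypothesis markovP : markov_law Q x P.
Variable G : set X.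
Hypothesis mG : measurable G.
Local Open Scope ereal_scope.

(** The image of [P] under the initial coordinate is the Dirac mass at [x]. *)
Lemma markov_initial (f : X -> \bar R) : (forall z, 0 <= f z) ->
  measurable_fun setT f -> \int[P]_w f (coordinate 0 w) = f x.
Proof.
move=> f0 mf; have mc := measurable_coordinate 0.
rewrite -(ge0_integral_pushforward mc P measurableT mf); last by move=> ? _.
rewrite (eq_measure_integral (dirac x)); last by move=> B mB _; exact: markovP.1.
by rewrite integral_dirac// diracT mul1e.
Qed.

(** The Markov property at time [t] trades one step of survival for one more constraint on the
    trajectory. The induction on [n] therefore needs [t] to vary. *)
Lemma survival_shift n t :
  \int[P]_(w in stay G t) (survival Q G n (coordinate t w))%:E =
  P (stay G (t + n)).
Proof.
have mstay := measurable_stay _ mG.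
elim: n t => [|n IHn] t.
  rewrite addn0 (integral_indic P (mstay t)); last first.
    by rewrite -[X in measurable X]setTI; exact: measurable_coordinate.
  (* [stay G t] includes time [t] itself, so it absorbs the event that coordinate [t] lies in
     [G]. *)
  by congr (P _); apply/setIidPr => w; apply; exact: leqnn.
have [ms s01] := survival_measurable01 Q mG n.
rewrite addnS -addSn -IHn stayS integral_mkcondr.
transitivity (\int[P]_(w in stay G t) \int[Q (coordinate t w)]_y
    (survival Q G n y)%:E).
  apply: eq_integral => w /set_mem sw.
  rewrite survivalS; last by apply: sw; exact: leqnn.
  by rewrite EFin_kernel_integral//; exact: survival_measurable01.
(* The disintegrating kernel is [Q (coordinate t w)], the conditional law of the next coordinate
   given the past. *)
rewrite -(@ge0_disintegration _ _ _ _ _ P _ _ (coordinate t.+1))//.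
(* Survival vanishes off [G], so requiring coordinate [t.+1] to lie in [G] leaves the integral
   unchanged. *)
- apply: eq_integral => w _; rewrite patchE; case: ifPn => // /negP nGw.
  by rewrite survival_out// => Gw; apply: nGw; exact/mem_set.
- move=> B mB.
  exact: measurableT_comp (measurable_kernel Q B mB) (measurable_coordinate t).
- exact: measurable_coordinate.
- move=> B mB; have [_ _] := markovP.2 t B mB.
  by apply; exact: past_stay.
- by move=> z; rewrite lee_fin; case/andP: (s01 z).
- exact/measurable_EFinP.
Qed.

(** This is [survival_shift] at time zero, where the initial coordinate is distributed as the Dirac
    mass at [x]. *)
Lemma survivalE n : (survival Q G n x)%:E = P (stay G n).
Proof.
have [ms s01] := survival_measurable01 Q mG n.
rewrite -(@markov_initial (fun z => (survival Q G n z)%:E)) => [|z|].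
- rewrite -[n in RHS]add0n -survival_shift [RHS]integral_mkcond.
  apply: eq_integral => w _; rewrite patchE; case: ifPn => // /negP nGw.
  rewrite /= survival_out// => Gw; apply: nGw; apply/mem_set => i /=.
  by rewrite leqn0 => /eqP ->.
- by rewrite lee_fin; case/andP: (s01 z).
- exact/measurable_EFinP.
Qed.

(** Continuity from above of [P] along the decreasing events [stay G n]. *)
Lemma survival_cvg0 : P (\bigcap_t stay G t) = 0 ->
  (survival Q G n x @[n --> \oo] --> 0)%R.
Proof.
move=> Pstay0.
have : (P \o stay G) n @[n --> \oo] --> P (\bigcap_t stay G t).
  apply: nonincreasing_cvg_mu => [|t||].
  - exact: le_lt_trans (probability_le1 _ (measurable_stay _ mG)) (ltry _).
  - exact: measurable_stay.
  - by apply: bigcapT_measurable => t; exact: measurable_stay.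
  - move=> m n mn; apply/subsetPset => w sw i /= im.
    by apply: sw; exact: leq_trans mn.
rewrite Pstay0 => /fine_cvg; rewrite /comp.
by under eq_fun do rewrite -survivalE.
Qed.

End trajectories.

(** * Finiteness of the exit time *)

Section exit.
Context d (X : measurableType d) (R : realType).

Lemma hitting_time_lty (B : set X) (w : trajectory X) :
  (hitting_time R B w < +oo)%E <-> exists t, B (coordinate t w).
Proof.
split => [/ereal_inf_lt[_ [t Bt _] _]|[t Bt]]; first by exists t.
by apply: le_lt_trans (ltry t%:R); apply: ereal_inf_lbound; exists t.
Qed.

(** [Psi] and the complement of [Phi]|[Psi] together make up the complement of [Phi]\[Psi], so one
    of the two times is finite exactly when the trajectory leaves that set. *)
Lemma exit_stay (Phi Psi : set X) :
  [set w : trajectory X | (mine (hitting_time R Psi w)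
    (hitting_time R (~` (Phi `|` Psi)) w) < +oo)%E] =
  ~` \bigcap_t stay (Phi `\` Psi) t.
Proof.
apply/seteqP; split=> w /=.
  rewrite gt_min => /orP[] /hitting_time_lty[t] Bt sw;
    have [Phit nPsit] := sw t Logic.I t (leqnn t) => //.
  by apply: Bt; left.
move=> nsw; have [t nGt] : exists t, ~ (Phi `\` Psi) (coordinate t w).
  apply: contrapT => nex; apply: nsw => t _ i _.
  by apply: contrapT => ?; apply: nex; exists i.
rewrite gt_min; apply/orP.
have [Psit|nPsit] := pselect (Psi (coordinate t w)).
  by left; apply/hitting_time_lty; exists t.
right; apply/hitting_time_lty; exists t => -[Phit|//]; exact: nGt.
Qed.

End exit.

Theorem proposition9 (R : realType) (S : topologicalType) (polS : polish R S)
    (A : set S) (borelA : borel_set A) (A0 : A !=set0)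
    (Q : R.-pker (borel_space A0) ~> (borel_space A0))
    (Phi Psi : set (borel_space A0))
    (mPhi : measurable Phi) (mPsi : measurable Psi)
    (P : borel_space A0 -> probability (trajectory (borel_space A0)) R)
    (markovP : forall x, markov_law Q x (P x))
    (exitP : forall x,
      P x [set w | (mine (hitting_time R Psi w)
                         (hitting_time R (~` (Phi `|` Psi)) w) < +oo)%E]
        = 1%E) :
  (forall u : borel_space A0 -> R, bounded_measurable01 Phi Psi u ->
     ((forall x, u x <= L Q Phi Psi u x) -> forall x, u x <= V Q Phi Psi x) /\
     ((forall x, u x >= L Q Phi Psi u x) -> forall x, u x >= V Q Phi Psi x)) /\
  [set u : borel_space A0 -> R |
     bounded_measurable01 Phi Psi u /\ u = L Q Phi Psi u] = [set V Q Phi Psi].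
Proof.
have survival0 x : survival Q (Phi `\` Psi) n x @[n --> \oo] --> 0.
  have mG : measurable (Phi `\` Psi) by exact: measurableD.
  apply: (survival_cvg0 (markovP x) mG).
  have mstay : measurable (\bigcap_t stay (Phi `\` Psi) t).
    by apply: bigcapT_measurable => t; exact: measurable_stay.
  move: (exitP x); rewrite exit_stay probability_setC// => /eqP.
  (* Writing the right-hand side as [1 - 0] lets the two differences be cancelled, once the
     probability is known to be a real number. *)
  rewrite -[X in _ == X]sube0 => /eqP.
  have /fineK <- : P x (\bigcap_t stay (Phi `\` Psi) t) \is a fin_num.
    exact: fin_num_measure.
  by rewrite -!EFinB => -[] /addrI /oppr_inj ->.
have subsolution u : bounded_measurable01 Phi Psi u ->
    (forall x, u x <= L Q Phi Psi u x) -> forall x, u x <= V Q Phi Psi x.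
  move=> u01 uL x; rewrite -subr_le0.
  (* The constant [u x - V x] lies below every survival term, hence below their limit zero. *)
  apply: (cvgr_to_ge (survival0 x)); near=> n; rewrite lerBlDl.
  apply: le_trans (subsolution_le_Viter mPhi mPsi u01 uL n x) _.
  by rewrite lerD2r Viter_le_V.
have V01 := V_bounded_measurable01 Q mPhi mPsi.
have mV01 := V_measurable01 Q mPhi mPsi.
split=> [u u01|]; first by split; [exact: subsolution|exact: V_le_supersolution].
apply/seteqP; split=> [u [u01 uL]|_ ->] /=.
  apply/funext => x; apply/le_anti/andP; split.
    by apply: subsolution => // y; rewrite -uL.
  by apply: V_le_supersolution => // y; rewrite -uL.
split=> //; apply/funext => x; apply/le_anti/andP; split; first exact: V_le_LV.
apply: subsolution; first exact: L_bounded_measurable01.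
apply: le_L => //; first exact: L_measurable01.
exact: V_le_LV.
Unshelve. all: by end_near. Qed.
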